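(* Let $\mathbb{K}\in\{\mathbb{R},\mathbb{C}\}$. Let $\{\bm{\varphi}_x\}_{x\in\Omega}$ be a family of vectors in $\mathbb{K}^n$, with arbitrary index set $\Omega$, and let $\bm{\varphi}:\Omega\to\mathbb{K}^n$ be the function $x\mapsto\bm{\varphi}_x$. For a positive definite Hermitian matrix $\bm{F}\in\mathbb{K}^{n\times n}$, the following assertions are equivalent. (i) $\bm{F}\in\operatorname{cone}\{\bm{\varphi}_x\bm{\varphi}_x^\ast: x\in\Omega\}$. (ii) There exists a positive measure $\mu$ on $\Omega$ such that $\bm{\varphi}$ is a $\mu$-frame for $\mathbb{K}^n$ with frame operator $S_{\bm{\varphi}}(\mu)=\bm{F}$. (iii) There exist $N\le\dim_{\mathbb{K}}\operatorname{lin}_{\mathbb{K}}\{\bm{\varphi}_x\bm{\varphi}_x^\ast: x\in\Omega\}$, points $x_1,\ldots,x_N\in\Omega$ and weights $\mu_1,\ldots,\mu_N>0$ such that $\bm{\varphi}$ is a $\widehat{\mu}$-frame with respect to the discrete measure $\widehat{\mu}=\sum_{j=1}^N\mu_j\delta_{x_j}$ and $S_{\bm{\varphi}}(\widehat{\mu})=\bm{F}$.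
   Context: $\bm{v}^\ast=\overline{\bm{v}}^\top$, $\operatorname{lin}_{\mathbb{K}}$ is the $\mathbb{K}$-linear span, and $\operatorname{cone}M:=\{\sum_{j=1}^m\lambda_jv_j: v_j\in M,\ \lambda_j\ge0,\ m\in\mathbb{N}\}$. For a positive measure space $(\Omega,\Sigma,\mu)$ (measure with values in $[0,\infty]$; in (ii) the $\sigma$-algebra is part of what is asserted to exist), a measurable function $\bm{\varphi}:\Omega\to\mathbb{K}^n$ is a $\mu$-frame for $\mathbb{K}^n$ if there are constants $0<A\le B<\infty$ with $$A\|f\|^2\le\int_\Omega|\langle f,\bm{\varphi}(x)\rangle|^2\,\mathrm{d}\mu(x)\le B\|f\|^2\quad\text{for all } f\in\mathbb{K}^n.$$ Its frame operator is $S_{\bm{\varphi}}(\mu)=\int_\Omega\bm{\varphi}(x)\bm{\varphi}(x)^\ast\,\mathrm{d}\mu(x)\in\mathbb{K}^{n\times n}$. *)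

(* Defs.v *)
From HB Require Import structures.
From mathcomp Require Import all_boot all_order all_algebra.
From mathcomp Require Import complex.
From mathcomp Require Import all_classical all_reals all_analysis.

Set Implicit Arguments.
Unset Strict Implicit.
Unset Printing Implicit Defensive.

Import Order.TTheory GRing.Theory Num.Theory.
Import numFieldNormedType.Exports.

Local Open Scope classical_set_scope.
Local Open Scope ring_scope.

Variant scalar_kind := RealScalars | ComplexScalars.

Definition scalar_field (R : realType) (k : scalar_kind) : numFieldType :=
  match k with
  | RealScalars => R
  | ComplexScalars => R[i]
  end.

Definition of_real {R : realType} {k : scalar_kind} : R -> scalar_field R k :=
  match k return R -> scalar_field R k with
  | RealScalars => fun a => a
  | ComplexScalars => fun a => Complex a 0
  end.

Definition conjK {R : realType} {k : scalar_kind} :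
    scalar_field R k -> scalar_field R k :=
  match k return scalar_field R k -> scalar_field R k with
  | RealScalars => fun z => z
  | ComplexScalars => fun z => conjc z
  end.

(* The modulus as a real number; on R[i] the norm `|z| is itself an element of
   R[i], with zero imaginary part. *)
Definition modulus {R : realType} {k : scalar_kind} : scalar_field R k -> R :=
  match k return scalar_field R k -> R with
  | RealScalars => fun z => `|z|
  | ComplexScalars => fun z => complex.Re `|z|
  end.

(* Vectors of K^n are columns. *)
Definition adjoint {R : realType} {k : scalar_kind} {m n : nat}
    (A : 'M[scalar_field R k]_(m, n)) : 'M[scalar_field R k]_(n, m) :=
  (map_mx conjK A)^T.

(* Linear in the first argument: <f, g> = g^* f. *)
Definition inner {R : realType} {k : scalar_kind} {n : nat}
    (f g : 'cV[scalar_field R k]_n) : scalar_field R k := (adjoint g *m f) 0 0.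

Definition sqnorm {R : realType} {k : scalar_kind} {n : nat}
    (f : 'cV[scalar_field R k]_n) : R := \sum_(i < n) modulus (f i 0) ^+ 2.

(* In the order of R[i], [0 < z] means that z is real and positive. *)
Definition posdef_hermitian {R : realType} {k : scalar_kind} {n : nat}
    (F : 'M[scalar_field R k]_n) : Prop :=
  adjoint F = F /\
  forall v : 'cV[scalar_field R k]_n, v != 0 -> 0 < (adjoint v *m F *m v) 0 0.

(* The empty sum (m = 0) is allowed, so that 0 always belongs to the cone. *)
Definition cone {R : realType} {k : scalar_kind} {V : lmodType (scalar_field R k)}
    (M : set V) : set V :=
  [set v | exists (m : nat) (lambda : 'I_m -> R) (w : 'I_m -> V),
    [/\ forall j, 0 <= lambda j, forall j, M (w j)
      & v = \sum_(j < m) of_real (lambda j) *: w j]].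

Definition is_lin {K : fieldType} {V : vectType K} (M : set V)
    (U : {vspace V}) : Prop :=
  forall v : V, v \in U <->
    exists (m : nat) (c : 'I_m -> K) (w : 'I_m -> V),
      (forall j, M (w j)) /\ v = \sum_(j < m) c j *: w j.

(* The linear span of an arbitrary, possibly infinite, set of vectors; the
   library only has spans of finite sequences. *)
Definition lin {K : fieldType} {V : vectType K} (M : set V) : {vspace V} :=
  xget 0%VS (is_lin M).

Lemma linP (K : fieldType) (V : vectType K) (M : set V) : is_lin M (lin M).
Proof.
suff [U MU] : exists U : {vspace V}, is_lin M U by exact: (xgetI 0%VS MU).
pose inM (X : seq V) := forall v, v \in X -> M v.
pose P := [pred d : nat | `[< exists X, inM X /\ \dim <<X>>%VS = d >]].
have exP : exists d, P d by exists (\dim <<[::] : seq V>>%VS); apply/asboolP; exists [::].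
have ubP d : P d -> (d <= \dim {: V})%N.
  by move=> /asboolP[X [_ <-]]; rewrite dimvS ?subvf.
case: (ex_maxnP exP ubP) => d /asboolP[X [XM dX]] dmax.
exists <<X>>%VS => v; split=> [vX|[m [c [w [wM ->]]]]].
  exists (size X), (coord (in_tuple X) ^~ v), (fun j => (in_tuple X)`_j).
  split=> [j|]; last exact: (@coord_span _ _ _ (in_tuple X)).
  by apply/XM/mem_nth.
apply: rpred_sum => j _; apply: rpredZ; set u := w j.
have uX : (\dim <<u :: X>>%VS <= \dim <<X>>%VS)%N.
  rewrite dX; apply: dmax; apply/asboolP; exists (u :: X); split=> // y.
  by rewrite inE => /predU1P[->|/XM //]; exact: wM.
have sX : (<<X>> <= <<u :: X>>)%VS by rewrite span_cons addvSr.
have /eqP-> : (<<X>>%VS == <<u :: X>>%VS) by rewrite eqEdim sX uX.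
by apply: memv_span; rewrite mem_head.
Qed.

(* A measure space (Om, Sigma, mu) is rendered inside an ambient type T with
   Om : set T, because the library's measurable types are inhabited while an
   index set may be empty. The sigma-algebra Sigma on Om generates the
   measurable sets of [g_sigma_algebraType Sigma]; those contained in Om are
   exactly the members of Sigma. A measure on T restricts to Om, every measure
   on Sigma is such a restriction, and all integrals below are over Om. *)
Section frames.
Context {R : realType} {k : scalar_kind} {d : measure_display}
  {T : measurableType d}.
Implicit Types (Om : set T) (mu : {measure set T -> \bar R}).

(* Borel measurability on Om, for the usual topology of K^n. *)
Definition vec_measurable {n : nat} Om
    (phi : T -> 'cV[scalar_field R k]_n) : Prop :=
  forall U : set 'cV[scalar_field R k]_n,
    open U -> measurable (Om `&` phi @^-1` U).

Definition is_frame {n : nat} mu Om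
    (phi : T -> 'cV[scalar_field R k]_n) : Prop :=
  vec_measurable Om phi /\
  exists A B : R, [/\ 0 < A, A <= B &
    forall f : 'cV[scalar_field R k]_n,
      ((A * sqnorm f)%:E <=
         \int[mu]_(x in Om) (modulus (inner f (phi x)) ^+ 2)%:E)%E /\
      (\int[mu]_(x in Om) (modulus (inner f (phi x)) ^+ 2)%:E <=
         (B * sqnorm f)%:E)%E].

End frames.

(* The integral of a K-valued function, by real and imaginary parts. *)
Definition integralK {R : realType} {k : scalar_kind} {d : measure_display}
    {T : measurableType d} (mu : {measure set T -> \bar R}) (Om : set T) :
    (T -> scalar_field R k) -> scalar_field R k :=
  match k return (T -> scalar_field R k) -> scalar_field R k with
  | RealScalars => fun f => \int[mu]_(x in Om) f x
  | ComplexScalars => fun f =>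
      Complex (\int[mu]_(x in Om) complex.Re (f x))
              (\int[mu]_(x in Om) complex.Im (f x))
  end.

(* Entrywise integral; the entries are integrable whenever phi is a frame. *)
Definition frame_operator {R : realType} {k : scalar_kind}
    {d : measure_display} {T : measurableType d} {n : nat}
    (mu : {measure set T -> \bar R}) (Om : set T)
    (phi : T -> 'cV[scalar_field R k]_n) : 'M[scalar_field R k]_n :=
  \matrix_(i, j) integralK mu Om (fun x => (phi x *m adjoint (phi x)) i j).

(* The sigma-algebra of all subsets of Om. *)
Definition discrete_space (T : pointedType) (Om : set T) : measurableType _ :=
  g_sigma_algebraType [set A : set T | A `<=` Om].

Section discrete_measure.
Local Open Scope ereal_scope.
Context {R : realType} {d : measure_display} {T : measurableType d} {N : nat}.
Variables (w : 'I_N -> {posnum R}) (x : 'I_N -> T).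

Definition discrete_measure (A : set T) : \bar R :=
  \sum_(j < N) ((w j)%:num)%:E * \d_(x j) A.

Let discrete_measure0 : discrete_measure set0 = 0.
Proof. by rewrite /discrete_measure big1// => j _; rewrite measure0 mule0. Qed.

Let discrete_measure_ge0 A : 0 <= discrete_measure A.
Proof. by apply: sume_ge0 => j _; rewrite mule_ge0. Qed.

Let discrete_measure_sigma_additive : semi_sigma_additive discrete_measure.
Proof.
move=> F mF tF mUF; rewrite [X in _ --> X](_ : _ =
    lim ((fun n => \sum_(0 <= i < n) discrete_measure (F i)) @ \oo)).
  by apply: is_cvg_ereal_nneg_natsum => i _; exact: discrete_measure_ge0.
rewrite /discrete_measure nneseries_sum//; last first.
  by move=> *; rewrite mule_ge0.
by apply: eq_bigr => /= i _; rewrite nneseriesZl// -measure_semi_bigcup.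
Qed.

HB.instance Definition _ := isMeasure.Build _ _ _ discrete_measure
  discrete_measure0 discrete_measure_ge0 discrete_measure_sigma_additive.

End discrete_measure.

Definition outer_products {R : realType} {k : scalar_kind} {T : Type} {n : nat}
    (Om : set T) (phi : T -> 'cV[scalar_field R k]_n) :
    set 'M[scalar_field R k]_n :=
  [set phi x *m adjoint (phi x) | x in Om].

(* Main.v *)
Require Import Defs.
From HB Require Import structures.
From mathcomp Require Import all_boot all_order all_algebra.
From mathcomp Require Import complex ring lra.
From mathcomp Require Import all_classical all_reals all_analysis.
From mathcomp Require Import measurable_realfun.

(** The implications proved are (i) => (iii) => (ii) => (i).

    (i) => (iii) is the conic Caratheodory theorem: a conic representation of F
    of minimal length has positive weights, and it cannot be longer than the
    dimension of the K-span, since otherwise a linear dependence between its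
    matrices could be used to cancel one of them ([conic_caratheodory]).  The
    dependence must have real coefficients whereas the span is taken over K;
    because the matrices phi_x phi_x^* are Hermitian, the conjugate of a
    K-linear dependence is again one, so that its real and imaginary parts are
    real dependences ([real_dependence]).  Atoms at the points found, with the
    weights found, have frame operator F.  The frame bounds follow from the
    invertibility of F: the upper one is Cauchy-Schwarz, and for the lower one
    the identity f = F^-1 (F f) expresses f through the numbers <f, phi_(x_j)>
    ([frame_upper_bound], [frame_lower_bound]).

    (iii) => (ii) holds because the measure of (iii) lives on the sigma-algebra
    of all subsets of Omega.

    (ii) => (i) says that an integral lies in the cone generated by the values of
    the integrand, although that cone need not be closed
    ([integral_conic_combination]).  If the integral b were outside the cone C, a
    nonzero linear functional l would satisfy l >= 0 on C and l(b) <= 0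
    ([convex_cone_separation]).  Then the nonnegative function l o g has
    integral l(b) <= 0, hence vanishes almost everywhere, and g may be
    restricted to the set where l o g = 0.  There it takes values in a
    hyperplane, and induction on the dimension applies.  The separation holds
    for arbitrary convex cones of a finite-dimensional real space, closed or
    not, and is obtained by extending a functional from a hyperplane as in the
    Hahn-Banach theorem ([convex_cone_full]). *)

Set Implicit Arguments.
Unset Strict Implicit.
Unset Printing Implicit Defensive.

Import Order.TTheory GRing.Theory Num.Theory.
Import numFieldNormedType.Exports.

Local Open Scope classical_set_scope.
Local Open Scope ring_scope.

(** * Separation for convex cones in R^m *)

Definition convex_cone (R : realType) (V : lmodType R) (C : set V) : Prop :=
  [/\ C 0, forall u v, C u -> C v -> C (u + v)
    & forall a u, 0 <= a -> C u -> C (a *: u)].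

(** A proper convex cone has a nonzero nonnegative functional, in contrapositive
    form.  By induction on the dimension: let hd be the first coordinate.  A
    functional h that is nonnegative on the slice C `&` {hd = 0} extends to the
    functional t * hd + h, nonnegative on C, where t is the supremum of the lower
    bounds that the vectors of C with hd > 0 impose; the vectors with hd < 0
    impose upper bounds, and a positive combination of two vectors on opposite
    sides lies in the slice, whence the compatibility.  So the slice satisfies the
    hypothesis, hence is the whole hyperplane, and vectors of C on both sides of
    it generate the rest. *)
Lemma convex_cone_full (R : realType) (m : nat) (C : set 'rV[R]_m) :
  convex_cone C ->
  (forall l : 'cV[R]_m, (forall u, C u -> 0 <= (u *m l) 0 0) -> l = 0) ->
  forall v, C v.
Proof.
elim: m C => [|m IH] C [C0 CD CZ] Cl v; first by rewrite thinmx0.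
pose hd (u : 'rV[R]_(1 + m)) : R := lsubmx u 0 0.
have pairE (u : 'rV[R]_(1 + m)) (t : R) (h : 'cV[R]_m) :
    (u *m col_mx t%:M h) 0 0 = hd u * t + (rsubmx u *m h) 0 0.
  rewrite -[in LHS](hsubmxK u) mul_row_col mul_mx_scalar mxE.
  by congr (_ + _); rewrite mxE mulrC.
have hd0 (u : 'rV[R]_(1 + m)) : hd u = 0 -> u = row_mx 0 (rsubmx u).
  move=> u0; rewrite -[LHS]hsubmxK; congr row_mx.
  by apply/matrixP => i j; rewrite !ord1 [RHS]mxE -[LHS]/(hd u) u0.
have side s : s != 0 -> exists u : 'rV[R]_(1 + m), C u /\ hd u * s < 0.
  move=> s_neq0; apply: contrapT => noside.
  have /(congr1 usubmx) : (col_mx s%:M 0 : 'cV[R]_(1 + m)) = 0.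
    apply: Cl => u Cu; rewrite pairE mulmx0 mxE addr0 leNgt.
    by apply/negP => us_lt0; apply: noside; exists u.
  rewrite col_mxKu linear0 => /matrixP /(_ 0 0); rewrite !mxE mulr1n.
  by move/eqP: s_neq0.
have [p [Cp]] := side (-1) ltac:(by rewrite oppr_eq0 oner_eq0).
rewrite mulrN1 oppr_lt0 => p_gt0.
have [q [Cq]] := side 1 (oner_neq0 _); rewrite mulr1 => q_lt0.
have slice (h : 'cV[R]_m) :
    (forall u : 'rV[R]_m, C (row_mx 0 u : 'rV_(1 + m)) -> 0 <= (u *m h) 0 0) ->
  h = 0.
  move=> h_ge0.
  (* The lower bounds on the coefficient of hd in the extended functional. *)
  pose S := [set s | exists u : 'rV[R]_(1 + m),
    [/\ C u, 0 < hd u & s = - (rsubmx u *m h) 0 0 / hd u]].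
  have cross (u w : 'rV[R]_(1 + m)) : C u -> C w -> 0 < hd u -> hd w < 0 ->
      - (rsubmx u *m h) 0 0 / hd u <= (rsubmx w *m h) 0 0 / - hd w.
    move=> Cu Cw u_gt0 w_lt0.
    have : C (row_mx 0 (rsubmx (- hd w *: u + hd u *: w)) : 'rV_(1 + m)).
      rewrite (_ : row_mx _ _ = - hd w *: u + hd u *: w); last first.
        rewrite -[RHS]hsubmxK; congr row_mx; apply/matrixP => i j.
        by rewrite !ord1 /hd !mxE; ring.
      by apply: CD; apply: CZ => //; lra.
    move/h_ge0.
    have -> : (rsubmx (- hd w *: u + hd u *: w) *m h) 0 0 =
        - hd w * (rsubmx u *m h) 0 0 + hd u * (rsubmx w *m h) 0 0.
      rewrite linearD !linearZ /= mulmxDl -!scalemxAl mxE.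
      by congr (_ + _); rewrite mxE.
    move=> le0.
    rewrite ler_pdivrMr // mulrAC ler_pdivlMr ?oppr_gt0 //; lra.
  have supS : has_sup S.
    split; first by exists (- (rsubmx p *m h) 0 0 / hd p), p.
    exists ((rsubmx q *m h) 0 0 / - hd q) => _ [u [Cu u_gt0 ->]].
    exact: cross.
  have tu (u : 'rV[R]_(1 + m)) : C u -> 0 < hd u ->
      0 <= hd u * sup S + (rsubmx u *m h) 0 0.
    move=> Cu u_gt0.
    have := sup_upper_bound supS (ex_intro _ u (And3 Cu u_gt0 erefl)).
    rewrite ler_pdivrMr //; lra.
  have tw (w : 'rV[R]_(1 + m)) : C w -> hd w < 0 ->
      0 <= hd w * sup S + (rsubmx w *m h) 0 0.
    move=> Cw w_lt0.
    have : sup S <= (rsubmx w *m h) 0 0 / - hd w.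
      by apply: ge_sup; [case: supS|move=> _ [u [Cu u_gt0 ->]]; exact: cross].
    rewrite ler_pdivlMr ?oppr_gt0 //; lra.
  have /(congr1 dsubmx) : (col_mx (sup S)%:M h : 'cV_(1 + m)) = 0.
    apply: Cl => u Cu; rewrite pairE.
    have [u_gt0|u_lt0|u0] := ltrgt0P (hd u); [exact: tu|exact: tw|].
    rewrite u0 mul0r add0r; apply: h_ge0.
    by rewrite -hd0.
  by rewrite col_mxKd linear0.
have hyper (w : 'rV[R]_(1 + m)) : hd w = 0 -> C w.
  move=> w0; rewrite (hd0 w w0).
  apply: (IH [set u | C (row_mx 0 u : 'rV_(1 + m))]) => //.
  split => [|u u' Cu Cu'|a u a_ge0 Cu] /=.
    - by rewrite row_mx0.
    - by rewrite -[0]addr0 -add_row_mx; apply: CD.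
    - by rewrite -[0](scaler0 _ a) -scale_row_mx; apply: CZ.
have hdB (u w : 'rV[R]_(1 + m)) a : hd (u - a *: w) = hd u - a * hd w.
  by rewrite /hd !mxE.
have [v_ge0|v_lt0] := leP 0 (hd v).
  rewrite -[v](subrK (hd v / hd p *: p)).
  apply: CD; last by apply: CZ => //; rewrite divr_ge0 // ltW.
  by apply: hyper; rewrite hdB divfK ?subrr // gt_eqF.
rewrite -[v](subrK (hd v / hd q *: q)).
apply: CD; last by apply: CZ => //; rewrite ltW // nmulr_rgt0 // invr_lt0.
by apply: hyper; rewrite hdB divfK ?subrr // lt_eqF.
Qed.

(** The functional comes from the cone C - R_+ b, which is proper: if it contained
    b = u - t b, then b = u / (1 + t) would be in C. *)
Lemma convex_cone_separation (R : realType) (m : nat) (C : set 'rV[R]_m)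
    (b : 'rV[R]_m) :
  convex_cone C -> ~ C b ->
  exists l : 'cV[R]_m, [/\ l != 0, forall u, C u -> 0 <= (u *m l) 0 0
    & (b *m l) 0 0 <= 0].
Proof.
move=> [C0 CD CZ] NCb; apply: contrapT => nosep; apply: NCb.
pose C' := [set v | exists u t, [/\ C u, 0 <= t & v = u - t *: b]].
have coneC' : convex_cone C'.
  split=> [|_ _ [u [s [Cu s_ge0 ->]]] [v [t [Cv t_ge0 ->]]]|
          a _ a_ge0 [u [s [Cu s_ge0 ->]]]].
  - by exists 0, 0; rewrite scale0r subr0.
  - by exists (u + v), (s + t); split; [exact: CD|exact: addr_ge0|
      rewrite scalerDl opprD addrACA].
  - by exists (a *: u), (a * s); split; [exact: CZ|exact: mulr_ge0|
      rewrite scalerBr scalerA].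
have [u [t [Cu t_ge0 def_b]]] : C' b.
  apply: (convex_cone_full coneC') => l l_ge0; apply: contrapT => /eqP l_neq0.
  apply: nosep; exists l; split=> // [u Cu|].
    by apply: l_ge0; exists u, 0; rewrite scale0r subr0.
  have : 0 <= (- b *m l) 0 0.
    by apply: l_ge0; exists 0, 1; rewrite scale1r sub0r.
  by rewrite mulNmx mxE oppr_ge0.
have t1 : 0 < 1 + t by lra.
rewrite (_ : b = (1 + t)^-1 *: u); first by apply: CZ => //; rewrite invr_ge0 ltW.
rewrite -[LHS](scalerK (lt0r_neq0 t1)); congr (_ *: _).
by rewrite scalerDl scale1r {1}def_b subrK.
Qed.

Definition conic_combination (R : realType) (T : Type) (V : lmodType R)
    (D : set T) (g : T -> V) : set V :=
  [set v | exists (N : nat) (c : 'I_N -> R) (x : 'I_N -> T),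
    [/\ forall j, 0 <= c j, forall j, D (x j) & v = \sum_(j < N) c j *: g (x j)]].

Lemma convex_cone_conic_combination (R : realType) (T : pointedType)
    (V : lmodType R) (D : set T) (g : T -> V) : convex_cone (conic_combination D g).
Proof.
split.
- by exists 0%N, (fun=> 0), (fun=> point); split=> [//|[]//|]; rewrite big_ord0.
- move=> _ _ [N [c [x [c_ge0 Dx ->]]]] [N' [c' [x' [c'_ge0 Dx' ->]]]].
  (* Concatenation of the two finite families. *)
  pose glue (U : Type) (u : 'I_N -> U) (u' : 'I_N' -> U) (j : 'I_(N + N')) :=
    match fintype.split j with inl i => u i | inr i => u' i end.
  exists (N + N')%N, (glue _ c c'), (glue _ x x').
  split=> [j|j|]; [by rewrite /glue; case: fintype.split..|].
  rewrite big_split_ord /glue; congr (_ + _); apply: eq_bigr => j _.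
    by rewrite (unsplitK (inl j)).
  by rewrite (unsplitK (inr j)).
- move=> a _ a_ge0 [N [c [x [c_ge0 Dx ->]]]].
  exists N, (fun j => a * c j), x; split=> // [j|]; first exact: mulr_ge0.
  by rewrite scaler_sumr; apply: eq_bigr => j _; rewrite scalerA.
Qed.

(** * Integrals lie in the cone of the values of the integrand *)

(** The cone need not be closed.  A functional l separating it weakly from the
    integral vanishes at g almost everywhere, and on {l . g = 0} the values of g
    are determined by the coordinates other than some i0 with
    l_i0 != 0, so that this coordinate can be dropped. *)
Lemma integral_conic_combination d (T : measurableType d) (R : realType)
    (mu : {measure set T -> \bar R}) (m : nat) (D : set T) (g : T -> 'rV[R]_m) :
  measurable D ->
  (forall i, mu.-integrable D (fun x => (g x 0 i)%:E)) ->
  conic_combination D g (\row_i \int[mu]_(x in D) g x 0 i).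
Proof.
elim: m D g => [|m IH] D g mD intg.
  exists 0%N, (fun=> 0), (fun=> point); split=> [//|[]//|].
  by rewrite big_ord0 [LHS]thinmx0.
set b := \row_i _; apply: contrapT => NCb.
have coneC := convex_cone_conic_combination D g.
have [l [l_neq0 l_ge0 bl_le0]] := convex_cone_separation coneC NCb.
pose f x := (g x *m l) 0 0.
have fE x : f x = \sum_i l i 0 * g x 0 i.
  by rewrite /f mxE; apply: eq_bigr => i _; rewrite mulrC.
have f_sumE : EFin \o f = fun x => (\sum_i (l i 0)%:E * (g x 0 i)%:E)%E.
  by apply/funext => x /=; rewrite fE -sumEFin.
have intf : mu.-integrable D (EFin \o f).
  by rewrite f_sumE; apply: integrable_sum => // i _; apply: integrableZl.
have f_ge0 x : D x -> 0 <= f x.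
  move=> Dx; apply: l_ge0; exists 1%N, (fun=> 1), (fun=> x); split=> //.
  by rewrite big_ord1 scale1r.
have int_f : (\int[mu]_(x in D) (f x)%:E = ((b *m l) 0 0)%:E)%E.
  rewrite (_ : (fun x => (f x)%:E) = EFin \o f) // f_sumE integral_sum //; last first.
    by move=> i; apply: integrableZl.
  rewrite mxE -sumEFin; apply: eq_bigr => i _.
  by rewrite integralZl // mxE mulrC EFinM fineK //; exact: integrable_fin_num.
have mf : measurable_fun D f by exact/measurable_EFinP/(measurable_int mu).
(* f is nonnegative with nonpositive integral. *)
have f_ae0 : ae_eq mu D (EFin \o f) (cst 0%E).
  apply/(ae_eq_integral_abs mu mD); first exact/measurable_EFinP.
  rewrite (eq_integral (EFin \o f)) => [|x /[!inE] Dx]; last first.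
    by rewrite /= ger0_norm ?f_ge0.
  apply/eqP; rewrite eq_le integral_ge0 => [|x Dx]; last by rewrite lee_fin f_ge0.
  by rewrite int_f lee_fin bl_le0.
pose D0 := D `&` [set x | f x = 0].
have mD0 : measurable D0 by exact: (mf mD _ (measurable_set1 0)).
have mDD0 : measurable (D `\` D0) by exact: measurableD.
have muDD0 : mu (D `\` D0) = 0.
  apply/eqP; rewrite -measure_le0.
  case: f_ae0 => B [mB muB0 sub]; rewrite -muB0; apply: le_measure; rewrite ?inE //.
  move=> x [Dx nD0x]; apply: sub => /= fx0; apply: nD0x; split=> //.
  by have [] := fx0 Dx.
have bE i : b 0 i = \int[mu]_(x in D0) g x 0 i.
  rewrite mxE /Rintegral (negligible_integral mDD0) // setDD.
  by rewrite setIA setIid.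
have [i0 li0] : exists i, l i 0 != 0.
  apply: contrapT => nol; move/eqP: l_neq0; apply; apply/matrixP => i j.
  rewrite ord1 mxE; apply: contrapT => /eqP li; apply: nol; by exists i.
have [] := IH D0 (fun x => col' i0 (g x)) mD0.
  move=> i; apply: (integrableS mD) => //; first by move=> x [].
  by rewrite (_ : (fun x => _) = fun x => (g x 0 (lift i0 i))%:E) //;
     apply/funext => x; rewrite mxE.
move=> N [c [x [c_ge0 D0x bE']]].
apply: NCb; exists N, c, x; split=> // [j|]; first by case: (D0x j).
have bl0 : (b *m l) 0 0 = 0.
  apply/le_anti/andP; split=> //.
  by rewrite -lee_fin -int_f integral_ge0 // => x Dx; rewrite lee_fin f_ge0.
pose v := b - \sum_(j < N) c j *: g (x j).
have v_lift i : v 0 (lift i0 i) = 0.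
  move/rowP: bE' => /(_ i); rewrite !mxE !summxE /=.
  under eq_Rintegral do rewrite mxE.
  under eq_bigr do rewrite !mxE.
  move=> gE; move: (bE (lift i0 i)); rewrite mxE gE => ->.
  by rewrite -sumrB big1 // => j _; rewrite mxE subrr.
have : (v *m l) 0 0 = 0.
  rewrite mulmxBl mulmx_suml mxE bl0 add0r mxE summxE big1 ?oppr0 // => j _.
  by rewrite -scalemxAl mxE; have [_ fx0] := D0x j;
    rewrite -[X in _ * X]/(f (x j)) fx0 mulr0.
rewrite mxE (bigD1 i0) //= big1 ?addr0 => [/eqP|i]; last first.
  by case: (unliftP i0 i) => [j ->|->]; rewrite ?eqxx // v_lift mul0r.
rewrite mulf_eq0 (negbTE li0) orbF => /eqP vi0.
apply/eqP; rewrite -subr_eq0; apply/eqP/rowP => i; rewrite [RHS]mxE.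
by case: (unliftP i0 i) => [j ->|->]; [exact: v_lift|].
Qed.

(** * Real and imaginary parts of scalars *)

Definition reK {R : realType} {k : scalar_kind} : scalar_field R k -> R :=
  match k return scalar_field R k -> R with
  | RealScalars => fun z => z
  | ComplexScalars => fun z => complex.Re z
  end.

(** With [imK] equal to 0 over R, both cases of K have the same arithmetic. *)
Definition imK {R : realType} {k : scalar_kind} : scalar_field R k -> R :=
  match k return scalar_field R k -> R with
  | RealScalars => fun=> 0
  | ComplexScalars => fun z => complex.Im z
  end.

Section scalars.
Context {R : realType} {k : scalar_kind}.
Local Notation K := (scalar_field R k).
Implicit Types (z w : K) (a b : R).

Lemma scalar_ext z w : reK z = reK w -> imK z = imK w -> z = w.
Proof. by case: k z w => //= -[a b] [c d] /= -> ->. Qed.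

Lemma reK_is_additive : zmod_morphism (@reK R k).
Proof. by rewrite /reK; case: k => // -[a b] [c d]. Qed.

Lemma imK_is_additive : zmod_morphism (@imK R k).
Proof. by rewrite /imK; case: k => [z w|[a b] [c d]] //; rewrite subr0. Qed.

Lemma conjK_is_additive : zmod_morphism (@conjK R k).
Proof. by rewrite /conjK; case: k => // z w; rewrite rmorphB. Qed.

Lemma conjK_is_multiplicative : monoid_morphism (@conjK R k).
Proof.
rewrite /conjK; case: k; first by split.
by split=> [|z w]; [rewrite rmorph1|rewrite rmorphM].
Qed.

Lemma of_real_is_additive : zmod_morphism (@of_real R k).
Proof. by rewrite /of_real; case: k => // a b; rewrite -[RHS]/(Complex _ _) subr0. Qed.

Lemma of_real_is_multiplicative : monoid_morphism (@of_real R k).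
Proof.
rewrite /of_real; case: k; first by split.
by split=> // a b; rewrite -[RHS]/(Complex _ _) !mulr0 mul0r subr0 addr0.
Qed.

HB.instance Definition _ :=
  GRing.isZmodMorphism.Build R K (@of_real R k) of_real_is_additive.
HB.instance Definition _ :=
  GRing.isMonoidMorphism.Build R K (@of_real R k) of_real_is_multiplicative.
HB.instance Definition _ :=
  GRing.isZmodMorphism.Build K R (@reK R k) reK_is_additive.
HB.instance Definition _ :=
  GRing.isZmodMorphism.Build K R (@imK R k) imK_is_additive.
HB.instance Definition _ :=
  GRing.isZmodMorphism.Build K K (@conjK R k) conjK_is_additive.
HB.instance Definition _ :=
  GRing.isMonoidMorphism.Build K K (@conjK R k) conjK_is_multiplicative.

Lemma reKM z w : reK (z * w) = reK z * reK w - imK z * imK w.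
Proof.
rewrite /reK /imK; case: k z w => [z w|[a b] [c d]] //=.
by rewrite mulr0 subr0.
Qed.

Lemma imKM z w : imK (z * w) = reK z * imK w + imK z * reK w.
Proof.
rewrite /reK /imK; case: k z w => [z w|[a b] [c d]] //=.
by rewrite mulr0 mul0r addr0.
Qed.

Lemma reK_of_real a : reK (of_real a : K) = a.
Proof. by rewrite /reK /of_real; case: k. Qed.

Lemma imK_of_real a : imK (of_real a : K) = 0.
Proof. by rewrite /imK /of_real; case: k. Qed.

Lemma reK_conjK z : reK (conjK z) = reK z.
Proof. by rewrite /reK /conjK; case: k z => // -[a b]. Qed.

Lemma imK_conjK z : imK (conjK z) = - imK z.
Proof. by rewrite /imK /conjK; case: k z => [z|[a b]] //=; rewrite oppr0. Qed.

Lemma conjKK : involutive (@conjK R k).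
Proof. by move=> z; apply: scalar_ext; rewrite ?reK_conjK ?imK_conjK ?opprK. Qed.

Lemma reK_of_realM a z : reK (of_real a * z) = a * reK z.
Proof. by rewrite reKM reK_of_real imK_of_real mul0r subr0. Qed.

Lemma imK_of_realM a z : imK (of_real a * z) = a * imK z.
Proof. by rewrite imKM reK_of_real imK_of_real mul0r addr0. Qed.

Lemma modulus_sqE z : modulus z ^+ 2 = reK z ^+ 2 + imK z ^+ 2.
Proof.
rewrite /modulus /reK /imK; case: k z => [z|z].
  by rewrite real_normK ?num_real // expr0n addr0.
by rewrite normc_def /= sqr_sqrtr // addr_ge0 ?sqr_ge0.
Qed.

Lemma modulus_sqM z w : modulus (z * w) ^+ 2 = modulus z ^+ 2 * modulus w ^+ 2.
Proof. by rewrite !modulus_sqE reKM imKM; ring. Qed.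

Lemma modulus_sq_conjK z : modulus (conjK z) ^+ 2 = modulus z ^+ 2.
Proof. by rewrite !modulus_sqE reK_conjK imK_conjK sqrrN. Qed.

Lemma modulus_of_real_sq a : modulus (of_real a : K) ^+ 2 = a ^+ 2.
Proof. by rewrite modulus_sqE reK_of_real imK_of_real expr0n addr0. Qed.

Lemma of_real_lt a b : ((of_real a : K) < of_real b) = (a < b).
Proof. by rewrite /of_real; case: k => //; rewrite ltcR. Qed.

Lemma of_real_gt0 a : 0 < a -> 0 < (of_real a : K).
Proof. by rewrite -of_real_lt; rewrite /of_real; case: k. Qed.

Lemma norm_of_real a : `|of_real a : K| = of_real `|a|.
Proof.
rewrite /of_real; case: k => //.
by rewrite normc_def /= expr0n addr0 sqrtr_sqr.
Qed.

Lemma reK_lipschitz z : `|of_real (reK z) : K| <= `|z|.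
Proof.
rewrite /reK /of_real; case: k z => // z; rewrite normc_def.
by rewrite normc_def lecR ler_wsqrtr //= expr0n addr0 lerDl sqr_ge0.
Qed.

Lemma imK_lipschitz z : `|of_real (imK z) : K| <= `|z|.
Proof.
rewrite /imK /of_real; case: k z => [z|z]; first by rewrite normr0.
by rewrite !normc_def lecR ler_wsqrtr //= expr0n addr0 lerDr sqr_ge0.
Qed.

Lemma reK_continuous : continuous (@reK R k).
Proof.
move=> z U /nbhs_ballP[e e_gt0 Ue]; apply/nbhs_ballP.
exists (of_real e) => /=; first exact: of_real_gt0.
move=> w zw; apply: Ue; rewrite /ball /= in zw *.
rewrite -raddfB.
have := le_lt_trans (reK_lipschitz _) zw.
rewrite norm_of_real of_real_lt //.
Qed.

Lemma imK_continuous : continuous (@imK R k).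
Proof.
move=> z U /nbhs_ballP[e e_gt0 Ue]; apply/nbhs_ballP.
exists (of_real e) => /=; first exact: of_real_gt0.
move=> w zw; apply: Ue; rewrite /ball /= in zw *.
rewrite -raddfB.
have := le_lt_trans (imK_lipschitz _) zw.
rewrite norm_of_real of_real_lt //.
Qed.

End scalars.

(** Cauchy-Schwarz against the constant vector 1. *)
Lemma sqr_sum_le (R : realType) (N : nat) (a : 'I_N -> R) :
  (\sum_j a j) ^+ 2 <= N%:R * \sum_j a j ^+ 2.
Proof.
have -> : N%:R * \sum_j a j ^+ 2 = \sum_i \sum_j (a i ^+ 2 + a j ^+ 2) / 2.
  under [RHS]eq_bigr do rewrite -mulr_suml big_split /= sumr_const card_ord.
  rewrite -mulr_suml big_split /= sumr_const card_ord sumrMnl mulrDl -splitr.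
  by rewrite mulr_natl.
rewrite expr2 mulr_suml; apply: ler_sum => i _.
rewrite mulr_sumr; apply: ler_sum => j _.
have := sqr_ge0 (a i - a j); lra.
Qed.

Section real_parts.
Context {R : realType} {k : scalar_kind}.
Local Notation K := (scalar_field R k).

Lemma of_real_reK (z : K) : of_real (reK z) = (z + conjK z) / 2.
Proof.
have -> : z + conjK z = of_real (reK z) * 2.
  rewrite mulr_natr; apply: scalar_ext; rewrite raddfMn raddfD /= ?reK_conjK.
    by rewrite reK_of_real mulr2n.
  by rewrite imK_conjK subrr imK_of_real mul0rn.
by rewrite mulfK // pnatr_eq0.
Qed.

(** This makes the imaginary parts of the coefficients of a dependence a K-linear
    combination of that dependence and its conjugate. *)
Lemma of_real_imK : exists u : K, forall z, of_real (imK z) = (z - conjK z) * u.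
Proof.
rewrite /imK /conjK /of_real; case: k; first by exists 0 => z; rewrite mulr0.
exists (Complex 0 (- 2^-1)) => -[a b].
by congr Complex; rewrite /=; field.
Qed.

End real_parts.

(** * Conic Caratheodory theorem for the matrices phi_x phi_x^* *)

Section outer_products.
Context {R : realType} {k : scalar_kind} {n : nat} {T : Type}.
Local Notation K := (scalar_field R k).
Variables (Om : set T) (phi : T -> 'cV[K]_n).

Definition outer x : 'M[K]_n := phi x *m adjoint (phi x).

Lemma outerE x i j : outer x i j = phi x i 0 * conjK (phi x j 0).
Proof. by rewrite mxE big_ord1 !mxE. Qed.

(** The matrices are Hermitian: conjugate the (b, a) entry of the dependence to get
    the (a, b) entry of the conjugate one. *)
Lemma conj_dependence (N : nat) (x : 'I_N -> T) (c : 'I_N -> K) :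
  \sum_j c j *: outer (x j) = 0 -> \sum_j conjK (c j) *: outer (x j) = 0.
Proof.
move=> /matrixP dep; apply/matrixP => a b; move: (dep b a).
rewrite !summxE !mxE => /(congr1 conjK); rewrite raddf0 raddf_sum => dep'.
rewrite -[RHS]dep'.
apply: eq_bigr => j _ /=; rewrite [in LHS]mxE [in RHS]mxE !outerE !rmorphM /= conjKK.
by rewrite [X in _ * X]mulrC.
Qed.

(** The span is over K, but decreasing nonnegative weights needs real coefficients:
    the real and imaginary parts of a K-dependence are dependences, by
    [conj_dependence], and one of them is nonzero. *)
Lemma real_dependence (N : nat) (x : 'I_N -> T) :
  (forall j, Om (x j)) -> (\dim (lin (outer_products Om phi)) < N)%N ->
  exists r : 'I_N -> R,
    (exists j, 0 < r j) /\ \sum_j of_real (r j) *: outer (x j) = 0.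
Proof.
move=> Omx ltN.
pose X := [tuple outer (x j) | j < N].
have [c [dep [i ci]]] : exists c : 'I_N -> K,
    \sum_j c j *: outer (x j) = 0 /\ exists i, c i != 0.
  apply: contrapT => indep; move: ltN; apply/negP; rewrite -leqNgt.
  suff freeX : free X.
    rewrite -[leqLHS](size_tuple X) -(eqP freeX).
    apply/dimvS/span_subvP => _ /codomP[j ->].
    apply/linP; exists 1%N, (fun=> 1), (fun=> outer (x j)).
    by split=> [_|]; [exists (x j)|rewrite big_ord1 scale1r].
  apply/freeP => c dep i; apply: contrapT => /eqP ci; apply: indep.
  exists c; split; last by exists i.
  by rewrite -[RHS]dep; apply: eq_bigr => j _; rewrite nth_mktuple.
have [r [ri rdep]] : exists r : 'I_N -> R, r i != 0 /\
    \sum_j of_real (r j) *: outer (x j) = 0.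
  have [re0|re_neq0] := eqVneq (reK (c i)) 0; last first.
    exists (fun j => reK (c j)); split=> //.
    under eq_bigr do rewrite of_real_reK mulrC -scalerA scalerDl.
    by rewrite -scaler_sumr big_split /= dep conj_dependence // addr0 scaler0.
  exists (fun j => imK (c j)); split.
    apply: contraNneq ci => im0.
    by apply/eqP/scalar_ext; rewrite ?re0 ?im0 raddf0.
  have [u uE] := @of_real_imK R k.
  under eq_bigr do rewrite uE mulrC -scalerA scalerBl.
  by rewrite -scaler_sumr sumrB dep conj_dependence // subr0 scaler0.
have [r_gt0|r_le0] := ltP 0 (r i); first by exists r; split=> //; exists i.
exists (fun j => - r j); split.
  by exists i; rewrite oppr_gt0 lt_neqAle ri.
by under eq_bigr do rewrite raddfN scaleNr; rewrite sumrN rdep oppr0.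
Qed.

Definition conic_rep (F : 'M[K]_n) (m : nat) : Prop :=
  exists (c : 'I_m -> R) (x : 'I_m -> T),
    [/\ forall j, 0 <= c j, forall j, Om (x j)
      & F = \sum_j of_real (c j) *: outer (x j)].

(** The index [i] forces m > 0, so that [m.-1] is a true predecessor. *)
Lemma conic_rep_drop F m (c : 'I_m -> R) (x : 'I_m -> T) i :
  (forall j, 0 <= c j) -> (forall j, Om (x j)) -> c i = 0 ->
  F = \sum_j of_real (c j) *: outer (x j) -> conic_rep F m.-1.
Proof.
case: m c x i => [c x []//|m] c x i c_ge0 Omx ci0 ->.
exists (fun j => c (lift i j)), (fun j => x (lift i j)); split=> //=.
rewrite (bigD1_ord i) //= ci0 raddf0 scale0r add0r //.
Qed.

Lemma cone_outer_productsP F : cone (outer_products Om phi) F ->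
  exists m, conic_rep F m.
Proof.
move=> [m [c [w [c_ge0 Mw ->]]]]; exists m.
have /choice[x xP] j : exists x, Om x /\ outer x = w j.
  by have [x Omx xw] := Mw j; exists x.
exists c, x; split=> // [j|]; first by have [] := xP j.
by apply: eq_bigr => j _; have [_ ->] := xP j.
Qed.

(** In a shortest representation no weight can be made 0.  Subtracting t times a
    real dependence r with a positive entry, where t is the least ratio c_i / r_i
    over the indices with r_i > 0, keeps all weights nonnegative and makes one 0;
    so a shortest representation has no dependence. *)
Lemma conic_caratheodory F : cone (outer_products Om phi) F ->
  exists (N : nat) (w : 'I_N -> {posnum R}) (x : 'I_N -> T),
    [/\ (N <= \dim (lin (outer_products Om phi)))%N, forall j, Om (x j)
      & F = \sum_j of_real (w j)%:num *: outer (x j)].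
Proof.
move=> /cone_outer_productsP[m0 rep0].
have exrep : exists m, `[< conic_rep F m >] by exists m0; apply/asboolP.
case: (ex_minnP exrep) => m /asboolP[c [x [c_ge0 Omx FE]]] m_min.
have no_drop (c' : 'I_m -> R) i : (forall j, 0 <= c' j) ->
    F = \sum_j of_real (c' j) *: outer (x j) -> c' i != 0.
  move=> c'_ge0 FE'; apply/eqP => c'i0.
  have /m_min : `[< conic_rep F m.-1 >] by
    apply/asboolP; exact: conic_rep_drop c'i0 FE'.
  by case: (m) i {c' c'_ge0 FE' c'i0} => [[]//|m' _]; rewrite ltnn.
have c_gt0 j : 0 < c j by rewrite lt_neqAle eq_sym no_drop // c_ge0.
exists m, (fun j => PosNum (c_gt0 j)), x; split=> //.
rewrite leqNgt; apply/negP => lt_m.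
have [r [[i0 ri0] dep]] := real_dependence Omx lt_m.
pose i := [arg min_(i < i0 | 0 < r i) (c i / r i)]%O.
have [ri i_min] : 0 < r i /\ forall j, 0 < r j -> c i / r i <= c j / r j.
  by rewrite /i; case: arg_minP.
pose t := c i / r i.
have t_ge0 : 0 <= t by rewrite divr_ge0 // ltW.
(* The i-th weight is cancelled, against minimality. *)
suff : c i - t * r i != 0 by rewrite /t divfK ?subrr ?eqxx // gt_eqF.
apply: (no_drop (fun j => c j - t * r j)).
- move=> j; rewrite subr_ge0; have [rj|rj] := ltP 0 (r j).
    by rewrite -ler_pdivlMr // i_min.
  by rewrite (le_trans _ (c_ge0 j)) // mulr_ge0_le0.
- under eq_bigr do rewrite raddfB /= scalerBl.
  rewrite sumrB -FE.
  under [X in _ - X]eq_bigr do rewrite rmorphM /= -scalerA.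
  by rewrite -scaler_sumr dep scaler0 subr0.
Qed.

End outer_products.

(** * Frame bounds of a finite decomposition of F *)

Section frame_of_decomposition.
Context {R : realType} {k : scalar_kind} {n : nat}.
Local Notation K := (scalar_field R k).

Lemma adjointK m p (A : 'M[K]_(m, p)) : adjoint (adjoint A) = A.
Proof. by apply/matrixP => i j; rewrite !mxE conjKK. Qed.

Lemma posdef_unitmx (F : 'M[K]_n) : posdef_hermitian F -> F \in unitmx.
Proof.
move=> [_ F_pos]; rewrite -row_free_unit; apply/inj_row_free => v vF0.
apply: contrapT => /eqP v_neq0.
have : adjoint v != 0.
  apply: contra_neq v_neq0 => v0; rewrite -[v]adjointK v0.
  by apply/matrixP => i j; rewrite !mxE raddf0.
by move/F_pos; rewrite adjointK vF0 mul0mx mxE ltxx.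
Qed.

Lemma modulus_sq_sum (N : nat) (z : 'I_N -> K) :
  modulus (\sum_j z j) ^+ 2 <= N%:R * \sum_j modulus (z j) ^+ 2.
Proof.
rewrite modulus_sqE !raddf_sum (le_trans (lerD (sqr_sum_le _) (sqr_sum_le _))) //.
rewrite -mulrDr -big_split ler_wpM2l //; apply: ler_sum => j _.
by rewrite modulus_sqE.
Qed.

(** Each |v_i|^2 is bounded by the whole of [sqnorm v], hence the factor n. *)
Lemma inner_le (f v : 'cV[K]_n) :
  modulus (inner f v) ^+ 2 <= n%:R * sqnorm v * sqnorm f.
Proof.
rewrite /inner mxE (le_trans (modulus_sq_sum _)) // -mulrA ler_wpM2l //.
rewrite /sqnorm mulr_sumr; apply: ler_sum => i _.
rewrite modulus_sqM !mxE modulus_sq_conjK ler_wpM2r ?sqr_ge0 //.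
by rewrite (bigD1 i) //= lerDl sumr_ge0 // => j _; rewrite sqr_ge0.
Qed.

Variables (T : Type) (phi : T -> 'cV[K]_n).
Variables (N : nat) (w : 'I_N -> R) (x : 'I_N -> T).
Hypothesis w_gt0 : forall j, 0 < w j.
Let F := \sum_j of_real (w j) *: outer phi (x j).
Let q f := \sum_j w j * modulus (inner f (phi (x j))) ^+ 2.

Lemma frame_upper_bound f :
  q f <= (\sum_j w j * (n%:R * sqnorm (phi (x j)))) * sqnorm f.
Proof.
rewrite /q mulr_suml; apply: ler_sum => j _.
by rewrite -mulrA ler_wpM2l ?inner_le // ltW.
Qed.

(** Since f = F^-1 (F f), the coordinate f_i is the sum over j of
    w_j c_ij <f, phi_(x_j)> with c_ij = (F^-1 phi_(x_j))_i, so |f_i|^2 is at most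
    a constant times q f. *)
Lemma frame_lower_bound : F \in unitmx ->
  exists C : R, 0 <= C /\ forall f, sqnorm f <= C * q f.
Proof.
move=> uF; pose c i j := (invmx F *m phi (x j)) i 0.
have c_ge0 : 0 <= N%:R * \sum_i \sum_j modulus (c i j) ^+ 2 * w j.
  by rewrite mulr_ge0 // sumr_ge0 // => i _; rewrite sumr_ge0 // => j _;
    rewrite mulr_ge0 ?sqr_ge0 // ltW.
exists (N%:R * \sum_i \sum_j modulus (c i j) ^+ 2 * w j); split=> // f.
have fE i : f i 0 = \sum_j of_real (w j) * (c i j * inner f (phi (x j))).
  have Ff : F *m f = \sum_j (of_real (w j) * inner f (phi (x j))) *: phi (x j).
    rewrite mulmx_suml; apply: eq_bigr => j _.
    rewrite -scalemxAl -mulmxA [_ *m f]mx11_scalar mul_mx_scalar scalerA //.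
  rewrite -[f in LHS](mulKmx uF) Ff mulmx_sumr summxE; apply: eq_bigr => j _.
  by rewrite -scalemxAr mxE mulrAC mulrA.
rewrite /sqnorm -mulrA mulr_suml mulr_sumr; apply: ler_sum => i _.
rewrite fE (le_trans (modulus_sq_sum _)) // ler_wpM2l // mulr_suml.
apply: ler_sum => j _; rewrite !modulus_sqM modulus_of_real_sq.
rewrite [leLHS](_ : _ = modulus (c i j) ^+ 2 * w j *
  (w j * modulus (inner f (phi (x j))) ^+ 2)); last by ring.
apply: ler_wpM2l; first by apply: mulr_ge0; [exact: sqr_ge0|exact: ltW].
rewrite /q (bigD1 j) //= lerDl sumr_ge0 // => l _.
by rewrite mulr_ge0 ?sqr_ge0 ?(ltW (w_gt0 _)).
Qed.

End frame_of_decomposition.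

(** * Discrete measures *)

Section discrete.
Context {R : realType} {T : pointedType} (Om : set T).
Local Notation D := (discrete_space Om).

Lemma discrete_measurable (A : set D) : A `<=` Om -> measurable A.
Proof. by move=> AOm; exact: sub_sigma_algebra. Qed.

Lemma discrete_measurable_fun d (U : measurableType d) (h : D -> U) :
  measurable_fun (Om : set D) h.
Proof. by move=> _ A _; apply: discrete_measurable => x []. Qed.

(** For nonnegative functions this is additivity and homogeneity in the measure;
    the general case splits h into its positive and negative parts, both of which
    have finite integral. *)
Lemma integral_discrete (N : nat) (w : 'I_N -> {posnum R}) (x : 'I_N -> D)
    (h : D -> R) : (forall j, Om (x j)) ->
  (\int[discrete_measure w x]_(y in (Om : set D)) (h y)%:E =
   (\sum_j (w j)%:num * h (x j))%:E)%E.
Proof.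
move=> Omx.
have mOm : measurable (Om : set D) by exact: discrete_measurable.
have w_ge0 j : 0 <= (w j)%:num by [].
(* The i-th atom, extended by zero to all i : nat as [msum] requires. *)
pose m_ (i : nat) : {measure set D -> \bar R} :=
  match insub i with
  | Some j => mscale (NngNum (w_ge0 j)) (dirac (x j))
  | None => mzero
  end.
have ge0_case (f : D -> \bar R) : (forall y, 0 <= f y)%E ->
    (\int[discrete_measure w x]_(y in (Om : set D)) f y =
     \sum_j (w j)%:num%:E * f (x j))%E.
  move=> f_ge0.
  rewrite (eq_measure_integral (msum m_ N)) => [|A mA _]; last first.
    by apply: eq_bigr => j _; rewrite /m_ valK.
  rewrite ge0_integral_measure_sum //; last exact: discrete_measurable_fun.
  apply: eq_bigr => j _; rewrite /m_ valK.
  rewrite ge0_integral_mscale //; last exact: discrete_measurable_fun.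
  rewrite integral_dirac //; last exact: discrete_measurable_fun.
  by rewrite diracE mem_set // mul1e.
rewrite integralE !ge0_case // -sumEFin.
rewrite (eq_bigr (fun j => ((w j)%:num * Num.max (h (x j)) 0)%:E)); last first.
  by move=> j _; rewrite funeposE -EFin_max -EFinM.
rewrite [X in (_ - X)%E](eq_bigr
    (fun j => ((w j)%:num * Num.max (- h (x j)) 0)%:E)); last first.
  by move=> j _; rewrite funenegE -EFinN -EFin_max -EFinM.
rewrite !sumEFin -EFinB; congr EFin.
rewrite -sumrB; apply: eq_bigr => j _; rewrite -mulrBr; congr (_ * _).
rewrite /Num.max /= oppr_lt0.
by have [_|_|->] := ltrgt0P (h (x j)); rewrite ?oppr0 ?sub0r ?opprK ?addr0.
Qed.

End discrete.

Section integralK.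
Context {R : realType} {k : scalar_kind} {d : measure_display}
  {T : measurableType d} (mu : {measure set T -> \bar R}) (D : set T).
Variable f : T -> scalar_field R k.

Lemma reK_integralK : reK (integralK mu D f) = \int[mu]_(x in D) reK (f x).
Proof. by rewrite /integralK /reK; case: k f. Qed.

Lemma imK_integralK : imK (integralK mu D f) = \int[mu]_(x in D) imK (f x).
Proof.
rewrite /integralK /imK; case: k f => // _.
by rewrite /Rintegral integral0.
Qed.

End integralK.

Lemma discrete_frame_operator (R : realType) (k : scalar_kind) (n : nat)
    (T : pointedType) (Om : set T) (phi : T -> 'cV[scalar_field R k]_n) (N : nat)
    (w : 'I_N -> {posnum R}) (x : 'I_N -> discrete_space Om) :
  (forall j, Om (x j)) ->
  frame_operator (discrete_measure w x) Om phi =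
    \sum_j of_real (w j)%:num *: outer phi (x j).
Proof.
move=> Omx; apply/matrixP => a b; rewrite mxE summxE; apply: scalar_ext.
  rewrite reK_integralK raddf_sum /Rintegral integral_discrete //=.
  by apply: eq_bigr => j _; rewrite /= [in RHS]mxE reK_of_realM.
rewrite imK_integralK raddf_sum /Rintegral integral_discrete //=.
by apply: eq_bigr => j _; rewrite /= [in RHS]mxE imK_of_realM.
Qed.

(** The lower bound is 1 / (C + 1) rather than 1 / C because C may be 0, for
    instance when n = 0, and the upper one is enlarged to exceed it. *)
Lemma discrete_frame (R : realType) (k : scalar_kind) (n : nat) (T : pointedType)
    (Om : set T) (phi : T -> 'cV[scalar_field R k]_n) (N : nat)
    (w : 'I_N -> {posnum R}) (x : 'I_N -> discrete_space Om) :
  (forall j, Om (x j)) ->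
  \sum_j of_real (w j)%:num *: outer phi (x j) \in unitmx ->
  is_frame (discrete_measure w x) Om phi.
Proof.
move=> Omx uF; split; first by move=> U _; apply: discrete_measurable => y [].
have w_gt0 j : 0 < (w j)%:num by [].
have [C [C_ge0 lower]] := frame_lower_bound w_gt0 uF.
have upper := frame_upper_bound phi x w_gt0.
set B := \sum_j _ * (_ * _) in upper.
have sq_ge0 f : 0 <= sqnorm f :> R by apply: sumr_ge0 => i _; exact: sqr_ge0.
exists (C + 1)^-1, (Num.max (C + 1)^-1 B).
have C1 : 0 < C + 1 by rewrite ltr_wpDl.
split=> [||f]; first by rewrite invr_gt0.
  by rewrite le_max lexx.
rewrite integral_discrete // !lee_fin; split.
  rewrite ler_pdivrMl // (le_trans (lower f)) // ler_wpM2r ?lerDl //.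
  by apply: sumr_ge0 => j _; rewrite mulr_ge0 // sqr_ge0.
rewrite (le_trans (upper f)) // ler_wpM2r //.
by rewrite le_max lexx orbT.
Qed.

(** * Frame operators lie in the cone *)

Lemma norm_dot_le (R : realDomainType) (a b c d : R) :
  `|a * c + b * d| <= (a ^+ 2 + b ^+ 2) + (c ^+ 2 + d ^+ 2).
Proof.
have := (sqr_ge0 (a + c), sqr_ge0 (a - c), sqr_ge0 (b + d), sqr_ge0 (b - d)).
have := (sqr_ge0 a, sqr_ge0 b, sqr_ge0 c, sqr_ge0 d).
rewrite ler_norml => -[[[a2 b2] c2] d2] [[[ac1 ac2] bd1] bd2].
by apply/andP; split; lra.
Qed.

Section frames.
Context {R : realType} {k : scalar_kind} {d : measure_display} {n : nat}
  {T : measurableType d}.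
Local Notation K := (scalar_field R k).
Variables (mu : {measure set T -> \bar R}) (Om : set T) (phi : T -> 'cV[K]_n).
Hypothesis mOm : measurable Om.

Lemma vec_measurable_comp (h : 'cV[K]_n -> R) :
  vec_measurable Om phi -> continuous h -> measurable_fun Om (h \o phi).
Proof.
move=> mphi /continuousP h_cont.
apply: (measurability _ (RGenOpens.measurableE R)).
move=> _ [_ [a [b ->] <-]].
by apply: (mphi (h @^-1` `]a, b[)); apply: h_cont; exact: interval_open.
Qed.

Hypothesis frame : is_frame mu Om phi.

Lemma measurable_reK_coord i : measurable_fun Om (fun x => reK (phi x i 0)).
Proof.
case: frame => mphi _.
apply: (vec_measurable_comp (h := fun v => reK (v i 0))) => // v.
by apply: continuous_comp; [exact: coord_continuous|exact: reK_continuous].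
Qed.

Lemma measurable_imK_coord i : measurable_fun Om (fun x => imK (phi x i 0)).
Proof.
case: frame => mphi _.
apply: (vec_measurable_comp (h := fun v => imK (v i 0))) => // v.
by apply: continuous_comp; [exact: coord_continuous|exact: imK_continuous].
Qed.

Lemma inner_delta_mx i (v : 'cV[K]_n) : inner (delta_mx i 0) v = conjK (v i 0).
Proof.
rewrite /inner mxE (bigD1 i) //= big1 => [|j ji]; last first.
  by rewrite [X in _ * X]mxE (negbTE ji) mulr0.
by rewrite !mxE !eqxx mulr1 addr0.
Qed.

(** The upper frame inequality at the i-th basis vector bounds the integral of
    |phi_i|^2. *)
Lemma integrable_modulus_sq_coord i :
  mu.-integrable Om (EFin \o (fun x => modulus (phi x i 0) ^+ 2)).
Proof.
apply/integrableP; split.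
  apply/measurable_EFinP; under eq_fun do rewrite modulus_sqE.
  by apply: measurable_funD; apply: measurable_funX;
    [exact: measurable_reK_coord|exact: measurable_imK_coord].
case: frame => _ [A [B [_ _ /(_ (delta_mx i 0))[_ le_B]]]].
apply: le_lt_trans (ltry (B * sqnorm (delta_mx i 0 : 'cV[K]_n))).
apply: le_trans le_B; rewrite le_eqVlt; apply/orP; left; apply/eqP.
apply: eq_integral => x _ /=.
by rewrite inner_delta_mx modulus_sq_conjK ger0_norm ?sqr_ge0.
Qed.

Lemma reK_outerE x i j : reK (outer phi x i j) =
  reK (phi x i 0) * reK (phi x j 0) + imK (phi x i 0) * imK (phi x j 0).
Proof. by rewrite outerE reKM reK_conjK imK_conjK mulrN opprK. Qed.

Lemma imK_outerE x i j : imK (outer phi x i j) =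
  imK (phi x i 0) * reK (phi x j 0) - reK (phi x i 0) * imK (phi x j 0).
Proof. by rewrite outerE imKM reK_conjK imK_conjK mulrN addrC. Qed.

Lemma integrable_dominated (h : T -> R) i j : measurable_fun Om h ->
  (forall x, `|h x| <= modulus (phi x i 0) ^+ 2 + modulus (phi x j 0) ^+ 2) ->
  mu.-integrable Om (EFin \o h).
Proof.
move=> mh h_le; apply: (@le_integrable _ _ _ mu _ mOm _
    (EFin \o (fun x => modulus (phi x i 0) ^+ 2 + modulus (phi x j 0) ^+ 2))).
- exact/measurable_EFinP.
- move=> x _; rewrite /= lee_fin (le_trans (h_le x)) // ler_norm //.
- exact: integrableD (integrable_modulus_sq_coord i) (integrable_modulus_sq_coord j).
Qed.

Lemma integrable_reK_outer i j :
  mu.-integrable Om (EFin \o (fun x => reK (outer phi x i j))).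
Proof.
apply: (integrable_dominated (i := i) (j := j)) => [|x].
  under eq_fun do rewrite reK_outerE.
  by apply: measurable_funD; apply: measurable_funM;
    do [exact: measurable_reK_coord|exact: measurable_imK_coord].
by rewrite reK_outerE !modulus_sqE norm_dot_le.
Qed.

Lemma integrable_imK_outer i j :
  mu.-integrable Om (EFin \o (fun x => imK (outer phi x i j))).
Proof.
apply: (integrable_dominated (i := i) (j := j)) => [|x].
  under eq_fun do rewrite imK_outerE.
  by apply: measurable_funB; apply: measurable_funM;
    do [exact: measurable_reK_coord|exact: measurable_imK_coord].
rewrite imK_outerE !modulus_sqE -mulrN (le_trans (norm_dot_le _ _ _ _)) //.
by rewrite sqrrN; lra.
Qed.

(** The n x n matrices over K are regarded as real vectors by listing the real and
    imaginary parts of their entries. *)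
Lemma frame_operator_cone :
  cone (outer_products Om phi) (frame_operator mu Om phi).
Proof.
(* The entry (i, j) gives its real part at true, its imaginary part at false. *)
pose I : finType := ('I_n * 'I_n * bool)%type.
pose coord (M : 'M[K]_n) (p : I) : R :=
  if p.2 then reK (M p.1.1 p.1.2) else imK (M p.1.1 p.1.2).
pose g x : 'rV[R]_#|I| := \row_l coord (outer phi x) (enum_val l).
have intg l : mu.-integrable Om (fun x => (g x 0 l)%:E).
  rewrite (_ : (fun x => _) = EFin \o (fun x => coord (outer phi x) (enum_val l))).
    rewrite /coord; case: (enum_val l) => -[i j] [];
      [exact: integrable_reK_outer|exact: integrable_imK_outer].
  by apply/funext => x; rewrite mxE.
have [N [c [x [c_ge0 Omx /rowP gE]]]] := integral_conic_combination mOm intg.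
exists N, c, (fun j => outer phi (x j)); split=> // [j|]; first by exists (x j).
have coordE p : coord (frame_operator mu Om phi) p =
    \sum_j c j * coord (outer phi (x j)) p.
  have := gE (enum_rank p); rewrite mxE summxE.
  under eq_Rintegral do rewrite mxE enum_rankK.
  under [RHS]eq_bigr do rewrite !mxE enum_rankK.
  move=> <-; rewrite /coord mxE; case: p.2; first by rewrite reK_integralK.
  by rewrite imK_integralK.
apply/matrixP => i j; rewrite summxE; apply: scalar_ext.
  rewrite raddf_sum; rewrite -[LHS]/(coord _ (i, j, true)) coordE.
  by apply: eq_bigr => l _ /=; rewrite [in RHS]mxE reK_of_realM.
rewrite raddf_sum; rewrite -[LHS]/(coord _ (i, j, false)) coordE.
by apply: eq_bigr => l _ /=; rewrite [in RHS]mxE imK_of_realM.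
Qed.

End frames.

(** * Equivalence *)

Unset Implicit Arguments.
Set Strict Implicit.
Set Printing Implicit Defensive.

Theorem theorem6p13 (R : realType) (k : scalar_kind) (n : nat)
    (T : pointedType) (Om : set T) (phi : T -> 'cV[scalar_field R k]_n)
    (F : 'M[scalar_field R k]_n) (hF : posdef_hermitian F) :
  [<-> cone (outer_products Om phi) F;

       exists (Sigma : set (set T)) (hSigma : sigma_algebra Om Sigma)
              (mu : {measure set (g_sigma_algebraType Sigma) -> \bar R}),
         is_frame mu Om phi /\ frame_operator mu Om phi = F;

       exists (N : nat) (x : 'I_N -> discrete_space Om) (w : 'I_N -> {posnum R}),
         [/\ (N <= \dim (lin (outer_products Om phi)))%N,
             forall j, Om (x j),
             is_frame (discrete_measure w x) Om phi
           & frame_operator (discrete_measure w x) Om phi = F]].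
Proof.
set P1 := cone _ _; set P2 := exists Sigma, _; set P3 := exists N, _.
have P13 : P1 -> P3.
  move=> /conic_caratheodory[N [w [x [leN Omx FE]]]].
  have unitF := posdef_unitmx hF.
  exists N, x, w; rewrite discrete_frame_operator // -FE; split=> //.
  by apply: discrete_frame => //; rewrite -FE.
have P32 : P3 -> P2.
  move=> [N [x [w [_ Omx frame opE]]]].
  exists [set A | A `<=` Om].
  have hSigma : sigma_algebra Om [set A | A `<=` Om].
    split=> [|A _|B BOm]; [exact: sub0set|exact: subDsetl|].
    by apply: bigcup_sub => i _; exact: BOm.
  by exists hSigma, (discrete_measure w x).
have P21 : P2 -> P1.
  move=> [Sigma [[Sigma0 SigmaC _] [mu [frame opE]]]].
  have mOm : measurable (Om : set (g_sigma_algebraType Sigma)).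
    by apply: sub_sigma_algebra; rewrite -[Om]setD0; exact: SigmaC.
  by rewrite /P1 -opE; exact: (frame_operator_cone mOm frame).
tfae.
- by move=> /P13/P32.
- by move=> /P21/P13.
- by move=> /P32/P21.
Qed.
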